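(* For any $B\in(0,1)$, there exists $\overline\alpha_f(B)>0$ such that for all $\alpha_f>\overline\alpha_f(B)$, $$\eta_{\mathrm{OS}}(B,0,\alpha_f)>\eta_{\mathrm{TS}}(B,0,\alpha_f).$$
   Context: For $b^{\mathrm L},b^{\mathrm R}\in[0,1]$ and a $2\times2$ matrix $\mathbf C=[c_{xy}]$ with non-negative entries, $G_n$ is the random bipartite graph with $n$ supply and $n$ demand nodes in which, independently over nodes, each supply node is of type 2 (flexible) with probability $b^{\mathrm L}$ and of type 1 (regular) otherwise, each demand node is of type 2 with probability $b^{\mathrm R}$ and of type 1 otherwise, and, conditional on types, a supply node of type $x$ and a demand node of type $y$ are connected independently with probability $c_{xy}/n$ ($n$ large). $M_\star(G_n)$ is the maximum matching size and $\eta(b^{\mathrm L},b^{\mathrm R};\mathbf C)=\lim_{n\to\infty}\mathbb E[M_\star(G_n)]/n$ (the limit exists). For $\alpha,\alpha_f\ge0$ and a flexibility budget $B\in(0,1]$, set $\mathbf C=\begin{bmatrix}2\alpha&\alpha+\alpha_f\\ \alpha+\alpha_f&2\alpha_f\end{bmatrix}$, $\eta_{\mathrm{OS}}(B,\alpha,\alpha_f)=\eta(B,0;\mathbf C)$ (one-sided allocation) and $\eta_{\mathrm{TS}}(B,\alpha,\alpha_f)=\eta(B/2,B/2;\mathbf C)$ (two-sided allocation). The statement concerns $\alpha=0$. *)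

(* Defs.v *)
(* Built on MathComp and MathComp-Analysis. *)
From mathcomp Require Import all_boot all_order all_algebra.
From mathcomp Require Import all_classical all_reals all_analysis.
Set Implicit Arguments.
Unset Strict Implicit.
Unset Printing Implicit Defensive.
Import Order.TTheory GRing.Theory Num.Theory.
Import numFieldNormedType.Exports.
Local Open Scope ring_scope.

Definition is_matching (S D : finType) (M : {set S * D}) : bool :=
  [forall e in M, forall f in M, (e.1 == f.1) || (e.2 == f.2) ==> (e == f)].

(* A bipartite graph on S + D is given by its edge set, oriented from S to D. *)
Definition max_matching (S D : finType) (E : {set S * D}) : nat :=
  \max_(M : {set S * D} | (M \subset E) && is_matching M) #|M|.

(* Index 0 of a 2 x 2 matrix is type 1, index 1 is type 2. *)
Definition regular : 'I_2 := ord0.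
Definition flexible : 'I_2 := ord_max.

Definition type_prob (R : realType) (b : R) (x : 'I_2) : R :=
  if x == flexible then b else 1 - b.

(* The truncation at 1 only matters for the finitely many n < C x y. *)
Definition edge_prob (R : realType) (n : nat) (C : 'M[R]_2) (x y : 'I_2) : R :=
  Num.min 1 (C x y / n%:R).

(* Probability that the supply types are s, the demand types are t and the
   edge set is E. *)
Definition graph_prob (R : realType) (n : nat) (bL bR : R) (C : 'M[R]_2)
    (s t : {ffun 'I_n -> 'I_2}) (E : {set 'I_n * 'I_n}) : R :=
  (\prod_(i < n) type_prob bL (s i)) * (\prod_(j < n) type_prob bR (t j)) *
  \prod_(e : 'I_n * 'I_n)
    (if e \in E then edge_prob n C (s e.1) (t e.2)
     else 1 - edge_prob n C (s e.1) (t e.2)).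

Definition mean_max_matching (R : realType) (bL bR : R) (C : 'M[R]_2)
    (n : nat) : R :=
  \sum_(s : {ffun 'I_n -> 'I_2}) \sum_(t : {ffun 'I_n -> 'I_2})
    \sum_(E : {set 'I_n * 'I_n})
      graph_prob bL bR C s t E * (max_matching E)%:R.

Definition matching_ratio (R : realType) (bL bR : R) (C : 'M[R]_2) : R^nat :=
  fun n => mean_max_matching bL bR C n / n%:R.

(* [limn] is only meaningful on convergent sequences: see [eta_exists]. *)
Definition eta (R : realType) (bL bR : R) (C : 'M[R]_2) : R :=
  limn (matching_ratio bL bR C).

(* Existence of the limit defining [eta], the standing fact of the model; it
   follows from the Bordenave-Lelarge-Salez theorem on matchings in sparse
   random graphs. *)
Definition eta_exists (R : realType) : Prop :=
  forall (bL bR : R) (C : 'M[R]_2),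
    0 <= bL <= 1 -> 0 <= bR <= 1 -> (forall x y, 0 <= C x y) ->
    cvgn (matching_ratio bL bR C).

Definition conn_mx (R : realType) (alpha alphaf : R) : 'M[R]_2 :=
  \matrix_(x, y)
    if (x == regular) && (y == regular) then 2 * alpha
    else if (x == flexible) && (y == flexible) then 2 * alphaf
    else alpha + alphaf.

Definition eta_OS (R : realType) (B alpha alphaf : R) : R :=
  eta B 0 (conn_mx alpha alphaf).

Definition eta_TS (R : realType) (B alpha alphaf : R) : R :=
  eta (B / 2) (B / 2) (conn_mx alpha alphaf).

(* Main.v *)
(* Write a = alphaf and b = B/2. Both ratios tend to B as a grows; the losses
   are compared.
   Two-sided: the flexible demand nodes together with the flexible supply nodes
   having a regular neighbour form a vertex cover, so the loss is at least the
   fraction of flexible supply nodes without a regular neighbour, about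
   b exp(-(1 - b) a).
   One-sided: by the defect form of Hall's theorem the number d of unmatched
   flexible supply nodes is max (|X| - |N(X)|) over sets X of such nodes, hence
   exp(l d) <= Z with Z = sum_X exp(l (|X| - |N(X)|)). The mean of Z factors
   over the demand nodes and, for l a small multiple of a, is at most
   exp(n B exp(1 + l - a)) + 2. This bounds the loss by 2 B exp(1 + l - a) / l,
   which is negligible against exp(-(1 - b) a) as soon as l < b a. *)
Require Import Defs.
From mathcomp Require Import all_boot all_order all_algebra.
From mathcomp Require Import all_classical all_reals all_analysis.
From mathcomp Require Import zify ring lra.
Set Implicit Arguments.
Unset Strict Implicit.
Unset Printing Implicit Defensive.
Import Order.TTheory GRing.Theory Num.Theory.
Import numFieldNormedType.Exports.
Local Open Scope ring_scope.

(** * Matchings: the defect form of Hall's theorem and the cover bound *)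

Definition nbhd (S D : finType) (E : {set S * D}) (X : {set S}) : {set D} :=
  [set w | [exists u in X, (u, w) \in E]].

Lemma nbhdP (S D : finType) (E : {set S * D}) (X : {set S}) (w : D) :
  reflect (exists2 u, u \in X & (u, w) \in E) (w \in nbhd E X).
Proof. by rewrite inE; exact: exists_inP. Qed.

Lemma matching_leq_max (S D : finType) (E M : {set S * D}) :
  M \subset E -> is_matching M -> (#|M| <= max_matching E)%N.
Proof.
move=> sME mM; rewrite /max_matching.
by apply: (bigop.bigmax_sup M); rewrite ?sME ?mM.
Qed.

Lemma max_matching_sub (S D : finType) (E E' : {set S * D}) :
  E' \subset E -> (max_matching E' <= max_matching E)%N.
Proof.
move=> sE; apply/bigmax_leqP => M /andP[sM mM].
by apply: matching_leq_max => //; apply: fintype.subset_trans sM sE.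
Qed.

Lemma is_matchingP (S D : finType) (M : {set S * D}) :
  reflect (forall e f, e \in M -> f \in M ->
             (e.1 = f.1 -> e = f) /\ (e.2 = f.2 -> e = f))
          (is_matching M).
Proof.
apply: (iffP forallP) => [H e f eM fM | H e].
  have /implyP/(_ eM)/forallP/(_ f)/implyP/(_ fM)/implyP ef := H e.
  by split=> /eqP ?; apply/eqP/ef; apply/orP; [left | right].
apply/implyP => eM; apply/forallP => f; apply/implyP => fM; apply/implyP.
by case: (H e f eM fM) => h1 h2 /orP[/eqP/h1 ->|/eqP/h2 ->].
Qed.

(** Each reached demand node picks one neighbour in [F]. A node of [F] has at most one edge, so it
    is picked at most once and the picked edges form a matching. *)
Lemma leq_matching_nbhd (S D : finType) (E : {set S * D}) (F : {set S}) :
  (forall u w1 w2, u \in F -> (u, w1) \in E -> (u, w2) \in E -> w1 = w2) ->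
  (#|nbhd E F| <= max_matching E)%N.
Proof.
move=> deg1.
pose h w := [pick u | (u \in F) && ((u, w) \in E)].
pose M := [set e in E | h e.2 == Some e.1].
have MF e : e \in M -> [/\ e.1 \in F, e \in E & h e.2 = Some e.1].
  rewrite inE => /andP[eE /eqP he]; split=> //; move: he.
  by rewrite /h; case: pickP => // u /andP[uF _] [<-].
apply: (@leq_trans #|M|).
  apply: leq_trans (leq_imset_card snd M); apply/subset_leq_card/fintype.subsetP.
  move=> w /nbhdP[u uF uwE]; apply/imsetP.
  have : exists2 v, (v, w) \in E & h w = Some v.
    rewrite /h; case: pickP => [v /andP[_ vE]|/(_ u)]; first by exists v.
    by rewrite uF uwE.
  by case=> v vE hv; exists (v, w) => //; rewrite inE vE /= hv.
apply: matching_leq_max; first by apply/fintype.subsetP => e /MF[].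
apply/is_matchingP => -[u w] [u' w'] /MF[/= uF uE hu] /MF[/= uF' uE' hu'].
split=> [eu | ew]; first by subst u'; rewrite (deg1 _ _ _ uF uE uE').
by subst w'; move: hu'; rewrite hu => -[->].
Qed.

(* Submodularity of |N(X)| (Rado's argument): if a node of F has two edges, one
   of them can be deleted without violating the condition. *)
Lemma hall_defect (S D : finType) (E : {set S * D}) (F : {set S}) (d : nat) :
  (forall X : {set S}, X \subset F -> (#|X| <= #|nbhd E X| + d)%N) ->
  (#|F| <= max_matching E + d)%N.
Proof.
have [m] := ubnP #|E|; elim: m => // m IH in E * => ltEm hE.
have [/existsP[u /existsP[w1 /existsP[w2 /and4P[uF uE1 uE2 w12]]]]|noex] :=
  boolP [exists u, [exists w1, [exists w2,
     [&& u \in F, (u, w1) \in E, (u, w2) \in E & w1 != w2]]]]; last first.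
  apply: leq_trans (hE F _) _ => //; rewrite leq_add2r.
  apply: leq_matching_nbhd => u w1 w2 uF uE1 uE2; apply/eqP/negPn/negP => w12.
  case/negP: noex; apply/existsP; exists u; apply/existsP; exists w1.
  by apply/existsP; exists w2; rewrite uF uE1 uE2.
pose cond (E' : {set S * D}) := [forall X : {set S},
  (X \subset F) ==> (#|X| <= #|nbhd E' X| + d)%N].
have step w : (u, w) \in E -> cond (E :\ (u, w)) -> (#|F| <= max_matching E + d)%N.
  move=> uE /forallP c; apply: leq_trans (IH (E :\ (u, w)) _ _) _.
  - by move: ltEm; rewrite (cardsD1 (u, w) E) uE add1n ltnS.
  - by move=> X; apply/implyP/c.
  - by rewrite leq_add2r; apply: max_matching_sub; apply: finset.subD1set.
have [/(step _ uE1)//|/forallPn[X1]] := boolP (cond (E :\ (u, w1))).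
have [/(step _ uE2)//|/forallPn[X2]] := boolP (cond (E :\ (u, w2))).
rewrite !negb_imply -!ltnNge => /andP[sX2 lt2] /andP[sX1 lt1].
(* A set violating the condition after the deletion contains [u]: otherwise the deletion leaves its
   neighbourhood unchanged. *)
have uX (X : {set S}) w : X \subset F ->
    (#|nbhd (E :\ (u, w)) X| + d < #|X|)%N -> u \in X.
  move=> sX lt; apply/negPn/negP => uX; move: lt; rewrite ltnNge => /negP; apply.
  apply: leq_trans (hE X sX) _; rewrite leq_add2r; apply: subset_leq_card.
  apply/fintype.subsetP => v /nbhdP[u' u'X u'E]; apply/nbhdP; exists u' => //.
  rewrite in_setD1 u'E andbT; apply: contraNneq uX => -[<- _] //.
have u1 := uX _ _ sX1 lt1; have u2 := uX _ _ sX2 lt2.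
set N1 := nbhd _ X1 in lt1; set N2 := nbhd _ X2 in lt2.
have sU : nbhd E (X1 :|: X2) \subset N1 :|: N2.
  apply/fintype.subsetP => v /nbhdP[u' u'X u'E]; rewrite finset.in_setU.
  have [[_ ->]|vw1] := eqVneq (u', v) (u, w1).
    apply/orP; right; apply/nbhdP; exists u => //.
    by rewrite in_setD1 uE1 andbT xpair_eqE eqxx.
  have [[_ ->]|vw2] := eqVneq (u', v) (u, w2).
    apply/orP; left; apply/nbhdP; exists u => //.
    by rewrite in_setD1 uE2 andbT xpair_eqE eqxx eq_sym.
  by move: u'X; rewrite finset.in_setU => /orP[] u'X; apply/orP; [left | right];
    apply/nbhdP; exists u' => //; rewrite in_setD1 u'E andbT.
(* Both deleted edges start at [u], so all other common nodes keep their neighbours in [N1] and in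
   [N2]. Leaving out [u] costs exactly one node. *)
have sI : nbhd E ((X1 :&: X2) :\ u) \subset N1 :&: N2.
  apply/fintype.subsetP => v /nbhdP[u' ].
  rewrite in_setD1 finset.in_setI => /and3P[u'u u'1 u'2] u'E.
  rewrite finset.in_setI; apply/andP; split; apply/nbhdP; exists u' => //;
    by rewrite in_setD1 u'E andbT xpair_eqE (negPf u'u).
have := hE (X1 :|: X2); rewrite finset.subUset sX1 sX2 => /(_ isT) leU.
have /hE leI : (X1 :&: X2) :\ u \subset F.
  apply: fintype.subset_trans sX1; apply: fintype.subset_trans (finset.subD1set _ _) _.
  exact: finset.subsetIl.
(* The violations give |X1| + |X2| >= |N1| + |N2| + 2d + 2, whereas [leU] and [leI] give |N1| + |N2|
   + 2d >= |X1| + |X2| - 1. *)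
have := subset_leq_card sU; have := subset_leq_card sI.
have := cardsUI X1 X2; have := cardsUI N1 N2.
have := cardsD1 u (X1 :&: X2); rewrite finset.in_setI u1 u2 /=.
lia.
Qed.

(** Weak duality: a matching edge is charged to its end in [A], or else to its end in [C], and no
    node is charged twice. *)
Lemma max_matching_cover (S D : finType) (E : {set S * D})
    (A : {set S}) (C : {set D}) :
  (forall e, e \in E -> (e.1 \in A) || (e.2 \in C)) ->
  (max_matching E <= #|A| + #|C|)%N.
Proof.
move=> cov; apply/bigmax_leqP => M /andP[sM /is_matchingP mM].
rewrite -(cardsID [set e | e.1 \in A] M); apply: leq_add.
  rewrite -(@card_in_imset _ _ fst); last first.
    by move=> e f; rewrite !finset.in_setI => /andP[eM _] /andP[fM _];
      case: (mM e f eM fM).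
  apply/subset_leq_card/fintype.subsetP => u /imsetP[e].
  by rewrite !inE => /andP[_ eA] ->.
rewrite -(@card_in_imset _ _ snd); last first.
  by move=> e f; rewrite !finset.in_setD => /andP[_ eM] /andP[_ fM];
    case: (mM e f eM fM).
apply/subset_leq_card/fintype.subsetP => u /imsetP[e].
rewrite !inE => /andP[eA eM] ->; have := cov e (fintype.subsetP sM e eM).
by rewrite (negPf eA).
Qed.

(** If every set had defect below d = |F| - [max_matching E], then [hall_defect] with d - 1 would
    match too many nodes. The predecessor is genuine only for d > 0; otherwise the empty set
    serves. *)
Lemma hall_defect_witness (S D : finType) (E : {set S * D}) (F : {set S}) :
  exists2 X : {set S}, X \subset F &
    (#|F| + #|nbhd E X| <= max_matching E + #|X|)%N.
Proof.
have [leFM|ltMF] := leqP #|F| (max_matching E).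
  exists finset.set0; first exact: finset.sub0set.
  rewrite cards0 addn0 (_ : nbhd E finset.set0 = finset.set0) ?cards0 ?addn0 //.
  by apply/finset.setP => w; rewrite [RHS]inE; apply/nbhdP => -[u]; rewrite inE.
have [/existsP[X /andP[sX lt]]|noX] := boolP [exists X : {set S},
    (X \subset F) && (#|nbhd E X| + (#|F| - max_matching E).-1 < #|X|)%N].
  by exists X => //; lia.
have /hall_defect : forall X : {set S}, X \subset F ->
    (#|X| <= #|nbhd E X| + (#|F| - max_matching E).-1)%N.
  move=> X sX; rewrite leqNgt; apply: contra noX => lt.
  by apply/existsP; exists X; rewrite sX.
lia.
Qed.

(** * Sums over type assignments and edge sets *)

Definition flex_nodes (n : nat) (s : {ffun 'I_n -> 'I_2}) : {set 'I_n} :=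
  [set i | s i == flexible].

Definition types_prob (R : realType) (n : nat) (b : R)
    (s : {ffun 'I_n -> 'I_2}) : R :=
  \prod_i type_prob b (s i).

Lemma prod_indicator (R : realType) (I : finType) (P Q : pred I) :
  \prod_(i | P i) (Q i)%:R = [forall (i | P i), Q i]%:R :> R.
Proof.
case: (boolP [forall (i | P i), Q i]) => [/forall_inP H|].
  by apply: big1 => i /H ->.
rewrite negb_forall => /existsP[i]; rewrite negb_imply => /andP[Pi nQi].
by rewrite (bigD1 i) //= (negPf nQi) mul0r.
Qed.

(** Independence of the types: distributivity turns the sum over assignments into a product over
    nodes. *)
Lemma sum_types_prod (R : realType) (n : nat) (b : R) (g : 'I_n -> 'I_2 -> R) :
  \sum_(s : {ffun 'I_n -> 'I_2}) types_prob b s * \prod_i g i (s i) =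
  \prod_i (b * g i flexible + (1 - b) * g i regular).
Proof.
transitivity (\sum_(s : {ffun 'I_n -> 'I_2})
    \prod_i (type_prob b (s i) * g i (s i))).
  by apply: eq_bigr => s _; rewrite /types_prob -big_split.
rewrite -(bigA_distr_bigA (fun i x => type_prob b x * g i x)).
apply: eq_bigr => i _; rewrite /= !big_ord_recl big_ord0 /= addr0 addrC.
by rewrite (_ : lift ord0 ord0 = flexible) //; apply: val_inj.
Qed.

Lemma sum_types_prob (R : realType) (n : nat) (b : R) :
  \sum_(s : {ffun 'I_n -> 'I_2}) types_prob b s = 1.
Proof.
transitivity (\sum_(s : {ffun 'I_n -> 'I_2}) types_prob b s * \prod_(i < n) 1).
  by apply: eq_bigr => s _; rewrite big1 ?mulr1.
by rewrite (sum_types_prod b (fun=> fun=> 1)) big1 // => i _; ring.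
Qed.

Lemma sum_types_flex (R : realType) (n : nat) (b : R) (X : {set 'I_n}) :
  \sum_(s : {ffun 'I_n -> 'I_2}) types_prob b s * (X \subset flex_nodes s)%:R =
  b ^+ #|X|.
Proof.
pose g (i : 'I_n) (x : 'I_2) : R := if i \in X then (x == flexible)%:R else 1.
transitivity (\sum_(s : {ffun 'I_n -> 'I_2}) types_prob b s * \prod_i g i (s i)).
  apply: eq_bigr => s _; congr (_ * _); rewrite -big_mkcond prod_indicator.
  congr ((nat_of_bool _)%:R); apply/fintype.subsetP/forall_inP => sX i /sX.
    by rewrite inE.
  by rewrite inE.
rewrite sum_types_prod -prodr_const [RHS]big_mkcond; apply: eq_bigr => i _.
by rewrite /g; case: ifP => _ /=; ring.
Qed.

Lemma types_prob_ge0 (R : realType) (n : nat) (b : R)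
    (s : {ffun 'I_n -> 'I_2}) : 0 <= b <= 1 -> 0 <= types_prob b s.
Proof.
move=> /andP[b0 b1]; apply: prodr_ge0 => i _; rewrite /type_prob.
by case: ifP; rewrite ?subr_ge0.
Qed.

Lemma sum_sets_prod (R : realType) (I : finType) (F G : I -> R) :
  \sum_(E : {set I}) \prod_i (if i \in E then F i else G i) =
  \prod_i (F i + G i).
Proof. by rewrite bigA_distr; apply: eq_bigl => E; rewrite inE. Qed.

Lemma sum_sets_expn (R : realType) (I : finType) (c : R) :
  \sum_(X : {set I}) c ^+ #|X| = (1 + c) ^+ #|I|.
Proof.
rewrite -prodr_const [1 + c]addrC -sum_sets_prod; apply: eq_bigr => X _.
by rewrite -prodr_const [LHS]big_mkcond.
Qed.

(** A pair outside [A] contributes P + (1 - P) = 1, while a pair of [A] has to be absent. *)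
Lemma sum_sets_avoid (R : realType) (I : finType) (P : I -> R) (A : {set I}) :
  \sum_(E : {set I}) (\prod_e (if e \in E then P e else 1 - P e)) *
     [disjoint A & E]%:R =
  \prod_(e in A) (1 - P e).
Proof.
transitivity (\sum_(E : {set I}) \prod_e
    (if e \in E then P e * (e \notin A)%:R else 1 - P e)).
  apply: eq_bigr => E _; rewrite disjoint_sym disjoint_subset.
  rewrite (_ : (E \subset _) = [forall (e | e \in E), e \notin A]); last first.
    by apply/fintype.subsetP/forall_inP.
  rewrite -prod_indicator [X in _ * X]big_mkcond -big_split /=.
  by apply: eq_bigr => e _; case: ifP; rewrite ?mulr1.
rewrite sum_sets_prod [RHS]big_mkcond; apply: eq_bigr => e _.
by case: (e \in A); rewrite /= ?mulr0 ?mulr1; ring.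
Qed.

Lemma edge_prob_bounds (R : realType) (n : nat) (C : 'M[R]_2) (x y : 'I_2) :
  (forall x y, 0 <= C x y) -> 0 <= edge_prob n C x y <= 1.
Proof.
by move=> C0; rewrite /edge_prob le_min ler01 divr_ge0 //= ge_min lexx.
Qed.

(** * Expectations over the random graph *)

(** [mean_max_matching] is convertible to an instance of this, which later rewrites with [expectD]
    and [expectZ] use. *)
Definition expect (R : realType) (bL bR : R) (C : 'M[R]_2) (n : nat)
    (f : {ffun 'I_n -> 'I_2} -> {ffun 'I_n -> 'I_2} -> {set 'I_n * 'I_n} -> R)
    : R :=
  \sum_s \sum_t \sum_E graph_prob bL bR C s t E * f s t E.

Lemma graph_prob_ge0 (R : realType) (n : nat) (bL bR : R) (C : 'M[R]_2)
    (s t : {ffun 'I_n -> 'I_2}) (E : {set 'I_n * 'I_n}) :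
  0 <= bL <= 1 -> 0 <= bR <= 1 -> (forall x y, 0 <= C x y) ->
  0 <= graph_prob bL bR C s t E.
Proof.
move=> hL hR C0; rewrite /graph_prob !mulr_ge0 //; try exact: types_prob_ge0.
apply: prodr_ge0 => e _.
have /andP[? ?] := edge_prob_bounds n (s e.1) (t e.2) C0.
by case: ifP; rewrite ?subr_ge0.
Qed.

(** The comparison is asked only on the support, so that graphs with an edge of probability 0 can be
    discarded. *)
Lemma expect_le (R : realType) (n : nat) (bL bR : R) (C : 'M[R]_2) f g :
  0 <= bL <= 1 -> 0 <= bR <= 1 -> (forall x y, 0 <= C x y) ->
  (forall s t E, graph_prob bL bR C s t E != 0 -> f s t E <= g s t E) ->
  @expect R bL bR C n f <= expect bL bR C g.
Proof.
move=> hL hR C0 fg; apply: ler_sum => s _; apply: ler_sum => t _; apply: ler_sum => E _.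
have [->|nz] := eqVneq (graph_prob bL bR C s t E) 0; first by rewrite !mul0r.
by apply: ler_wpM2l; [exact: graph_prob_ge0 | exact: fg].
Qed.

Lemma expectD (R : realType) (n : nat) (bL bR : R) (C : 'M[R]_2) f g :
  @expect R bL bR C n (fun s t E => f s t E + g s t E) =
  expect bL bR C f + expect bL bR C g.
Proof.
by rewrite -big_split /=; apply: eq_bigr => s _; rewrite -big_split;
  apply: eq_bigr => t _; rewrite -big_split /=; apply: eq_bigr => E _;
  rewrite -mulrDr.
Qed.

Lemma expectZ (R : realType) (n : nat) (bL bR : R) (C : 'M[R]_2) (c : R) f :
  @expect R bL bR C n (fun s t E => c * f s t E) = c * expect bL bR C f.
Proof.
by rewrite mulr_sumr; apply: eq_bigr => s _; rewrite mulr_sumr;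
  apply: eq_bigr => t _; rewrite mulr_sumr; apply: eq_bigr => E _;
  rewrite mulrCA.
Qed.

Lemma expect_sum (R : realType) (n : nat) (bL bR : R) (C : 'M[R]_2)
    (I : finType) f :
  @expect R bL bR C n (fun s t E => \sum_(i : I) f i s t E) =
  \sum_i expect bL bR C (f i).
Proof.
rewrite [RHS]exchange_big; apply: eq_bigr => s _.
rewrite [RHS]exchange_big; apply: eq_bigr => t _.
by rewrite [RHS]exchange_big; apply: eq_bigr => E _; rewrite mulr_sumr.
Qed.

(** Given the types, edges are independent, and both [h] and [A] depend on the types only; the sum
    over edge sets therefore collapses by [sum_sets_avoid]. *)
Lemma expect_avoid (R : realType) (n : nat) (bL bR : R) (C : 'M[R]_2)
    (h : {ffun 'I_n -> 'I_2} -> {ffun 'I_n -> 'I_2} -> R)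
    (A : {ffun 'I_n -> 'I_2} -> {ffun 'I_n -> 'I_2} -> {set 'I_n * 'I_n}) :
  expect bL bR C (fun s t E => h s t * [disjoint A s t & E]%:R) =
  \sum_s types_prob bL s * \sum_t types_prob bR t *
    (h s t * \prod_(e in A s t) (1 - edge_prob n C (s e.1) (t e.2))).
Proof.
apply: eq_bigr => s _; rewrite mulr_sumr; apply: eq_bigr => t _.
rewrite -sum_sets_avoid !mulr_sumr; apply: eq_bigr => E _.
by rewrite /graph_prob -!/(types_prob _ _) !mulrA; congr (_ * _); rewrite mulrAC.
Qed.

Lemma expect_types (R : realType) (n : nat) (bL bR : R) (C : 'M[R]_2) h :
  @expect R bL bR C n (fun s t _ => h s t) =
  \sum_s types_prob bL s * \sum_t types_prob bR t * h s t.
Proof.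
transitivity (@expect R bL bR C n (fun s t E => h s t * [disjoint finset.set0 & E]%:R)).
  do 3! (apply: eq_bigr => ? _).
  by rewrite -finset.setI_eq0 finset.set0I eqxx mulr1.
by rewrite expect_avoid; do 2! (apply: eq_bigr => ? _; congr (_ * _));
  rewrite big_set0 mulr1.
Qed.

Lemma expect_supply (R : realType) (n : nat) (bL bR : R) (C : 'M[R]_2) h :
  @expect R bL bR C n (fun s _ _ => h s) = \sum_s types_prob bL s * h s.
Proof.
rewrite (expect_types bL bR C (fun s _ => h s)); apply: eq_bigr => s _.
by rewrite -mulr_suml sum_types_prob mul1r.
Qed.

Lemma expect_demand (R : realType) (n : nat) (bL bR : R) (C : 'M[R]_2) h :
  @expect R bL bR C n (fun _ t _ => h t) = \sum_t types_prob bR t * h t.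
Proof.
rewrite (expect_types bL bR C (fun _ t => h t)).
by rewrite -mulr_suml sum_types_prob mul1r.
Qed.

Lemma sum_types_card_flex (R : realType) (n : nat) (b : R) :
  \sum_(s : {ffun 'I_n -> 'I_2}) types_prob b s * #|flex_nodes s|%:R = n%:R * b.
Proof.
transitivity (\sum_(i < n) \sum_(s : {ffun 'I_n -> 'I_2}) types_prob b s *
    ([set i] \subset flex_nodes s)%:R).
  rewrite exchange_big; apply: eq_bigr => s _; rewrite -mulr_sumr; congr (_ * _).
  rewrite -natr_sum -sum1_card big_mkcond; congr (_%:R); apply: eq_bigr => i _.
  by rewrite finset.sub1set; case: ifP.
transitivity (\sum_(i < n) b).
  by apply: eq_bigr => i _; rewrite sum_types_flex cards1 expr1.
by rewrite sumr_const card_ord mulr_natl.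
Qed.

(** * Exponential moment of the Hall defect *)

Lemma disjoint_setX_nbhd (S D : finType) (E : {set S * D}) (X : {set S})
    (Y : {set D}) :
  [disjoint finset.setX X Y & E] = [disjoint Y & nbhd E X].
Proof.
rewrite -!finset.setI_eq0; apply/eqP/eqP => dis; apply/finset.setP.
  move=> w; rewrite finset.in_setI finset.in_set0; apply/negbTE/negP.
  move=> /andP[wY /nbhdP[u uX uE]]; have /finset.setP/(_ (u, w)) := dis.
  by rewrite finset.in_setI finset.in_set0 finset.in_setX uX wY uE.
move=> [u w]; rewrite finset.in_setI finset.in_setX finset.in_set0.
apply/negbTE/negP => /andP[/andP[/= uX wY] uE].
have /finset.setP/(_ w) := dis; rewrite finset.in_setI finset.in_set0 wY /=.
by move=> /negP; apply; apply/nbhdP; exists u.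
Qed.

(** For p in [0,1], let [Y] contain each demand node independently with probability 1 - p: the power
    is the probability that [Y] misses the neighbourhood. This reduces it to edge avoidance, where
    [expect_avoid] applies. *)
Lemma expn_card_nbhd (R : realType) (S D : finType) (E : {set S * D})
    (X : {set S}) (p : R) :
  p ^+ #|nbhd E X| =
  \sum_(Y : {set D}) (\prod_w (if w \in Y then 1 - p else p)) *
     [disjoint finset.setX X Y & E]%:R.
Proof.
transitivity (\sum_(Y : {set D}) \prod_w
    (if w \in Y then (1 - p) * (w \notin nbhd E X)%:R else p)).
  rewrite sum_sets_prod -prodr_const [LHS]big_mkcond; apply: eq_bigr => w _.
  by case: (w \in nbhd E X); rewrite /= ?mulr0 ?mulr1; ring.
apply: eq_bigr => Y _; rewrite disjoint_setX_nbhd disjoint_subset.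
rewrite (_ : (Y \subset _) = [forall (w | w \in Y), w \notin nbhd E X]); last first.
  by apply/fintype.subsetP/forall_inP.
rewrite -prod_indicator [X in _ * X]big_mkcond -big_split /=.
by apply: eq_bigr => w _; case: ifP; rewrite ?mulr1.
Qed.

(** Each of the |X| |Y| pairs is absent with probability at most 1 - a/n <= exp(-a/n), whatever the
    demand type. The condition a <= n keeps a/n below the truncation at 1 in [edge_prob]. *)
Lemma expect_flex_avoid_le (R : realType) (n : nat) (bL bR a : R) (C : 'M[R]_2)
    (X Y : {set 'I_n}) :
  0 <= bL <= 1 -> 0 <= bR <= 1 -> (forall x y, 0 <= C x y) ->
  (forall y, a <= C flexible y) -> a <= n%:R ->
  expect bL bR C (fun s t E => (X \subset flex_nodes s)%:R *
     [disjoint finset.setX X Y & E]%:R) <=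
  bL ^+ #|X| * (expR (- (a / n%:R)) ^+ #|X|) ^+ #|Y|.
Proof.
move=> hL hR C0 aC an.
rewrite (expect_avoid bL bR C (fun s _ => (X \subset flex_nodes s)%:R)
  (fun _ _ => finset.setX X Y)).
set r := (_ ^+ #|Y| in leRHS).
apply: (@le_trans _ _ (\sum_s types_prob bL s * \sum_t types_prob bR t *
    ((X \subset flex_nodes s)%:R * r))).
  apply: ler_sum => s _; apply: ler_wpM2l; first exact: types_prob_ge0.
  apply: ler_sum => t _; apply: ler_wpM2l; first exact: types_prob_ge0.
  have [sX|_] := boolP (X \subset flex_nodes s); last by rewrite !mul0r.
  rewrite !mul1r /r -exprM -cardsX -prodr_const.
  apply: ler_prod => -[u w]; rewrite finset.in_setX => /andP[/= uX wY].
  have /andP[_ P1] := edge_prob_bounds n (s u) (t w) C0; rewrite subr_ge0 P1 /=.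
  have /eqP -> : s u == flexible.
    by have := fintype.subsetP sX u uX; rewrite inE.
  apply: le_trans (expR_ge1Dx _); rewrite lerD2l lerN2 /edge_prob le_min.
  have n0 : (0 < n)%N := leq_ltn_trans (leq0n u) (ltn_ord u).
  by rewrite ler_pdivrMr ?ltr0n // mul1r an ler_pM2r ?invr_gt0 ?ltr0n ?aC.
rewrite -sum_types_flex mulr_suml; apply: ler_sum => s _.
by rewrite -mulr_suml sum_types_prob mul1r mulrA.
Qed.

(** After expanding the power of p over random sets [Y], the average of q^|Y| with q = exp(-a/n)^|X|
    factors over the demand nodes, each giving p + (1 - p) q. *)
Lemma expect_nbhd_sum_le (R : realType) (n : nat) (bL bR a c p : R)
    (C : 'M[R]_2) :
  0 <= bL <= 1 -> 0 <= bR <= 1 -> (forall x y, 0 <= C x y) ->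
  (forall y, a <= C flexible y) -> a <= n%:R -> 0 <= c -> 0 <= p <= 1 ->
  expect bL bR C (fun s t (E : {set 'I_n * 'I_n}) =>
    \sum_(X : {set 'I_n}) c ^+ #|X| *
       ((X \subset flex_nodes s)%:R * p ^+ #|nbhd E X|)) <=
  \sum_(X : {set 'I_n}) (bL * c) ^+ #|X| *
     (p + (1 - p) * expR (- (a / n%:R)) ^+ #|X|) ^+ n.
Proof.
move=> hL hR C0 aC an c0 /andP[p0 p1].
rewrite (expect_sum bL bR C (fun (X : {set 'I_n}) s t E => c ^+ #|X| *
       ((X \subset flex_nodes s)%:R * p ^+ #|nbhd E X|))).
apply: ler_sum => X _.
rewrite (expectZ bL bR C (c ^+ #|X|) (fun s _ E =>
       ((X \subset flex_nodes s)%:R * p ^+ #|nbhd E X|))).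
rewrite exprMn mulrAC mulrC ler_wpM2r ?exprn_ge0 //.
pose w (Y : {set 'I_n}) := \prod_j (if j \in Y then 1 - p else p).
have w0 Y : 0 <= w Y.
  by apply: prodr_ge0 => j _; case: ifP; rewrite ?subr_ge0.
apply: (@le_trans _ _ (expect bL bR C (fun s t (E : {set 'I_n * 'I_n}) =>
    \sum_(Y : {set 'I_n}) w Y * ((X \subset flex_nodes s)%:R *
       [disjoint finset.setX X Y & E]%:R)))).
  apply: expect_le => // s t E _; rewrite expn_card_nbhd mulr_sumr.
  by apply: ler_sum => Y _; rewrite mulrCA.
rewrite (expect_sum bL bR C (fun (Y : {set 'I_n}) s t E => w Y * ((X \subset flex_nodes s)%:R *
       [disjoint finset.setX X Y & E]%:R))).
set q := expR _ ^+ _.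
apply: (@le_trans _ _ (\sum_(Y : {set 'I_n}) w Y * (bL ^+ #|X| * q ^+ #|Y|))).
  apply: ler_sum => Y _; rewrite (expectZ bL bR C (w Y) (fun s _ E =>
     ((X \subset flex_nodes s)%:R * [disjoint finset.setX X Y & E]%:R))).
  by apply: ler_wpM2l => //; apply: expect_flex_avoid_le.
rewrite le_eqVlt; apply/orP; left; apply/eqP.
under eq_bigr do rewrite mulrCA.
rewrite -mulr_sumr; congr (_ * _).
rewrite -[in RHS](card_ord n) addrC -prodr_const -sum_sets_prod.
apply: eq_bigr => Y _; rewrite /w -prodr_const [X in _ * X]big_mkcond.
by rewrite -big_split; apply: eq_bigr => j _ /=; case: ifP; rewrite ?mulr1.
Qed.

(* exp(l d - tau) >= 1 + l d - tau replaces the logarithm of the sum, so that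
   expectations can be taken termwise. *)
Lemma max_matching_deficit (R : realType) (n : nat) (s : {ffun 'I_n -> 'I_2})
    (E : {set 'I_n * 'I_n}) (l tau : R) : 0 <= l ->
  l * (#|flex_nodes s|%:R - (max_matching E)%:R) <= tau - 1 + expR (- tau) *
    \sum_(X : {set 'I_n}) expR l ^+ #|X| *
       ((X \subset flex_nodes s)%:R * expR (- l) ^+ #|nbhd E X|).
Proof.
move=> l0; have [X sX leX] := hall_defect_witness E (flex_nodes s).
set d := (_ - _); set Z := \sum_(X : {set _}) _.
suff dZ : expR (l * d) <= Z.
  have := expR_ge1Dx (l * d - tau); rewrite expRD [expR _ * _]mulrC.
  have := ler_wpM2l (expR_ge0 (- tau)) dZ; lra.
(* The term of the Hall witness [X] alone dominates exp(l d); the other terms are non-negative. *)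
rewrite /Z (bigD1 X) //= sX mul1r; apply: ler_wpDr.
  by apply: sumr_ge0 => Y _; rewrite !mulr_ge0 ?exprn_ge0 ?expR_ge0.
rewrite -!expRM_natr -expRD ler_expR mulNr -mulrBr ler_wpM2l // /d.
by rewrite lerBlDr addrAC lerBrDr -!natrD ler_nat [leqRHS]addnC.
Qed.

(** This is the mean of [max_matching_deficit], with [expect_nbhd_sum_le] taken at c = exp(l) and p
    = exp(-l). The parameter [tau] stays free until the size of the sum is known. *)
Lemma mean_max_matching_ge (R : realType) (n : nat) (bL bR a l tau : R)
    (C : 'M[R]_2) :
  0 <= bL <= 1 -> 0 <= bR <= 1 -> (forall x y, 0 <= C x y) ->
  (forall y, a <= C flexible y) -> a <= n%:R -> 0 <= l ->
  l * (n%:R * bL - mean_max_matching bL bR C n) <= tau - 1 + expR (- tau) *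
  \sum_(X : {set 'I_n}) (bL * expR l) ^+ #|X| *
     (expR (- l) + (1 - expR (- l)) * expR (- (a / n%:R)) ^+ #|X|) ^+ n.
Proof.
move=> hL hR C0 aC an l0.
have p01 : 0 <= expR (- l) <= 1 by rewrite expR_ge0 expR_le1 oppr_le0.
have leZ := expect_nbhd_sum_le hL hR C0 aC an (expR_ge0 l) p01.
apply: le_trans (_ : _ <= tau - 1 + expR (- tau) * _) _; last first.
  by rewrite lerD2l; apply: ler_wpM2l leZ; exact: expR_ge0.
rewrite -sum_types_card_flex -(expect_supply bL bR C (fun s => #|flex_nodes s|%:R)).
rewrite -(expectZ bL bR C (expR (- tau))) /=.
pose K := tau - 1.
have -> : tau - 1 = expect bL bR C (fun (s : {ffun 'I_n -> 'I_2}) _ _ => K).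
  by rewrite expect_supply -mulr_suml sum_types_prob mul1r.
rewrite -(expectD bL bR C (fun _ _ _ => K)).
rewrite -mulN1r -(expectZ bL bR C (-1) (fun _ _ E => (max_matching E)%:R)).
rewrite -(expectD bL bR C (fun s _ _ => #|flex_nodes s|%:R)) -expectZ.
apply: expect_le => // s t E _; rewrite mulN1r.
exact: max_matching_deficit.
Qed.

(** * Bounding the moment sum according to the size of the set *)

(** The left side is the factor of one demand node, with x = a |X| / n. It equals exp(-x) + exp(-l)
    (1 - exp(-x)), and x <= l/2 gives exp(-l) (1 - exp(-x)) <= exp(-x) x exp(-l/2). *)
Lemma mixture_le_small (R : realType) (l x : R) : 0 <= l -> 0 <= x <= l / 2 ->
  expR (- l) + (1 - expR (- l)) * expR (- x) <= expR (- x + x * expR (- (l / 2))).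
Proof.
move=> l0 /andP[x0 xl]; rewrite expRD.
apply: (@le_trans _ _ (expR (- x) * (1 + x * expR (- (l / 2))))); last first.
  by rewrite ler_pM2l ?expR_gt0 ?expR_ge1Dx.
have e2 : expR (- l) = expR (- (l / 2)) * expR (- (l / 2)).
  by rewrite -expRD; congr expR; lra.
have le2 := expR_ge1Dx (- x).
have lpx : expR (- (l / 2)) <= expR (- x) by rewrite ler_expR; lra.
have p0 := expR_gt0 (- (l / 2)).
rewrite e2; move: p0 le2 lpx; set p := expR (- (l / 2)); set q := expR (- x) => p0 le2 lpx.
have h1 : p * (1 - q) <= p * x by rewrite ler_pM2l //; lra.
have h2 : p * x <= q * x by rewrite ler_wpM2r.
have := ler_wpM2l (ltW p0) (le_trans h1 h2); lra.
Qed.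

Lemma mixture_le_mid (R : realType) (l x : R) : 0 <= l -> l / 2 <= x ->
  expR (- l) + (1 - expR (- l)) * expR (- x) <= 2 * expR (- (l / 2)).
Proof.
move=> l0 xl; have q0 := expR_gt0 (- x); have p0 := expR_gt0 (- l).
have : expR (- l) <= expR (- (l / 2)) by rewrite ler_expR; lra.
have : expR (- x) <= expR (- (l / 2)) by rewrite ler_expR; lra.
nra.
Qed.

Lemma mixture_le_large (R : realType) (l x : R) : 0 <= l -> l *+ 2 <= x ->
  expR (- l) + (1 - expR (- l)) * expR (- x) <= expR (- l) * (1 + expR (- l)).
Proof.
move=> l0 xl; have q0 := expR_gt0 (- x); have p0 := expR_gt0 (- l).
have : expR (- x) <= expR (- l) * expR (- l) by rewrite -expRD ler_expR; lra.
nra.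
Qed.

(** Every term is bounded by the sum of the bounds for three ranges of |X|, so each bound can be
    summed over all subsets by the binomial formula. The first total is at most exp(n dl); the last
    two hypotheses make the other totals at most 1 each. *)
Lemma exp_moment_sum_le (R : realType) (n : nat) (b a l : R) :
  (0 < n)%N -> 0 <= b <= 1 -> 0 < l -> l *+ 8 <= a ->
  a * expR (- (l / 2)) <= 1 -> 4 * expR (- (l / 4)) <= 1 ->
  (expR (- l) + b) * (1 + expR (- l)) <= 1 ->
  \sum_(X : {set 'I_n}) (b * expR l) ^+ #|X| *
     (expR (- l) + (1 - expR (- l)) * expR (- (a / n%:R)) ^+ #|X|) ^+ n <=
  expR (n%:R * (b * expR (1 + l - a))) + 2.
Proof.
move=> n0 /andP[b0 b1] l0 la h1 h2 h3.
have nR0 : 0 < n%:R :> R by rewrite ltr0n.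
set p := expR (- l); have p0 : 0 < p := expR_gt0 _.
have p1 : p <= 1 by rewrite expR_le1 oppr_le0 ltW.
set dl := b * expR (1 + l - a).
have dl0 : 0 <= dl by rewrite mulr_ge0 ?expR_ge0.
have bl0 : 0 <= b * expR l by rewrite mulr_ge0 ?expR_ge0.
apply: (@le_trans _ _ (\sum_(X : {set 'I_n}) (dl ^+ #|X| +
    (2 * expR (- (l / 4))) ^+ n + (b * expR l) ^+ #|X| * (p * (1 + p)) ^+ n))).
  apply: ler_sum => X _; set k := #|X|.
  pose x := a / n%:R * k%:R.
  have x0 : 0 <= x by rewrite mulr_ge0 ?divr_ge0 //; lra.
  have xn : x * n%:R = a * k%:R by rewrite /x; field; lra.
  rewrite (_ : expR (- (a / n%:R)) ^+ k = expR (- x)); last first.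
    by rewrite -expRM_natr mulNr.
  have f0 : 0 <= p + (1 - p) * expR (- x).
    by rewrite addr_ge0 ?mulr_ge0 ?expR_ge0 //; lra.
  have t1 : 0 <= dl ^+ k by rewrite exprn_ge0.
  have t2 : 0 <= (2 * expR (- (l / 4))) ^+ n.
    by rewrite exprn_ge0 ?mulr_ge0 ?expR_ge0.
  have t3 : 0 <= (b * expR l) ^+ k * (p * (1 + p)) ^+ n.
    by rewrite mulr_ge0 ?exprn_ge0 ?mulr_ge0 //; lra.
  (* X small: it contributes as if its nodes were isolated independently.
     In the two other ranges the n-th power alone beats the number of sets. *)
  have [xl|xl] := leP x (l / 2).
    suff : (b * expR l) ^+ k * (p + (1 - p) * expR (- x)) ^+ n <= dl ^+ k by lra.
    rewrite /dl (_ : 1 + l - a = l + (1 - a)); last by lra.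
    rewrite expRD mulrA [leRHS]exprMn.
    apply: ler_wpM2l; first by rewrite exprn_ge0.
    apply: (@le_trans _ _ (expR (- x + x * expR (- (l / 2))) ^+ n)).
      by rewrite lerXn2r ?nnegrE ?expR_ge0 // mixture_le_small ?x0 // ltW.
    (* Since x n = a k, the correction in the exponent is a k exp(-l/2) <= k by [h1]; this is the 1
       in exp(1 + l - a). *)
    rewrite -!expRM_natr ler_expR mulrDl mulNr xn mulrAC xn.
    have : 0 <= k%:R :> R by [].
    nra.
  have [xl2|xl2] := leP x (l *+ 2).
    suff : (b * expR l) ^+ k * (p + (1 - p) * expR (- x)) ^+ n <=
           (2 * expR (- (l / 4))) ^+ n by lra.
    apply: (@le_trans _ _ (expR (l * k%:R) * (2 * expR (- (l / 2))) ^+ n)).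
      apply: ler_pM; rewrite ?exprn_ge0 //.
        rewrite expRM_natr lerXn2r ?nnegrE ?expR_ge0 //.
        by rewrite ler_piMl ?expR_ge0.
      rewrite lerXn2r ?nnegrE ?mulr_ge0 ?expR_ge0 // mixture_le_mid //; exact: ltW.
    rewrite !exprMn mulrCA ler_pM2l ?exprn_gt0 // -!expRM_natr -expRD ler_expR.
    (* From x <= 2 l and 8 l <= a follows k <= n/4, so exp(l k) uses up only half of the decay
       exp(-l n / 2). *)
    have kn : k%:R * 4 <= n%:R :> R.
      rewrite -(ler_pM2l l0) -(ler_pM2r (_ : 0 < 2 :> R)) //.
      have : 0 <= k%:R :> R by [].
      nra.
    nra.
  suff : (b * expR l) ^+ k * (p + (1 - p) * expR (- x)) ^+ n <=
      (b * expR l) ^+ k * (p * (1 + p)) ^+ n by lra.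
  apply: ler_wpM2l; first by rewrite exprn_ge0.
  rewrite lerXn2r ?nnegrE ?mulr_ge0 ?mixture_le_large //; lra.
have -> : \sum_(X : {set 'I_n}) (dl ^+ #|X| + (2 * expR (- (l / 4))) ^+ n +
      (b * expR l) ^+ #|X| * (p * (1 + p)) ^+ n) =
    (1 + dl) ^+ n + (4 * expR (- (l / 4))) ^+ n +
    ((1 + b * expR l) * (p * (1 + p))) ^+ n.
  rewrite !big_split /= -mulr_suml !sum_sets_expn card_ord.
  congr (_ + _ + _); last by rewrite -exprMn.
  (* Writing the constant with a factor 1^|X| produces the number 2^n of subsets, which turns the 2
     into a 4. *)
  transitivity (\sum_(X : {set 'I_n}) 1 ^+ #|X| * (2 * expR (- (l / 4))) ^+ n).
    by apply: eq_bigr => X _; rewrite expr1n mul1r.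
  rewrite -mulr_suml sum_sets_expn card_ord -exprMn; congr (_ ^+ _); ring.
have pl : expR l * p = 1 by rewrite -expRD subrr expR0.
have -> : (1 + b * expR l) * (p * (1 + p)) = (p + b) * (1 + p).
  transitivity ((p + b * (expR l * p)) * (1 + p)); [ring | by rewrite pl mulr1].
rewrite -addrA; apply: lerD.
  rewrite expRM_natl lerXn2r ?nnegrE ?expR_ge0 ?expR_ge1Dx //; lra.
have h4 : (4 * expR (- (l / 4))) ^+ n <= 1.
  by rewrite exprn_ile1 ?mulr_ge0 ?expR_ge0.
have : ((p + b) * (1 + p)) ^+ n <= 1.
  by rewrite exprn_ile1 ?mulr_ge0 //; lra.
lra.
Qed.

Lemma eta_ge (R : realType) (bL bR a l : R) (C : 'M[R]_2) :
  eta_exists R ->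
  0 < bL <= 1 -> 0 <= bR <= 1 -> (forall x y, 0 <= C x y) ->
  (forall y, a <= C flexible y) -> 0 < l -> l *+ 8 <= a ->
  a * expR (- (l / 2)) <= 1 -> 4 * expR (- (l / 4)) <= 1 ->
  (expR (- l) + bL) * (1 + expR (- l)) <= 1 ->
  bL - 2 * (bL * expR (1 + l - a)) / l <= eta bL bR C.
Proof.
move=> ex /andP[bL0 bL1] hR C0 aC l0 la h1 h2 h3.
have hL : 0 <= bL <= 1 by rewrite ltW.
set dl := bL * _; have dl0 : 0 < dl by rewrite mulr_gt0 ?expR_gt0.
apply: limr_ge; first exact: ex.
near=> n.
have n0 : (0 < n)%N by near: n; exact: nbhs_infty_gt.
have an : a <= n%:R by near: n; exact: nbhs_infty_ger.
have dn : 2 / dl <= n%:R by near: n; exact: nbhs_infty_ger.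
have nR0 : 0 < n%:R :> R by rewrite ltr0n.
(* The choice tau = n dl cancels the main term exp(n dl) of the moment bound. What remains is n dl -
   1 + 3, at most 2 n dl by [dn]; hence the factor 2 in the conclusion. *)
have := mean_max_matching_ge (n%:R * dl) hL hR C0 aC an (ltW l0).
have := exp_moment_sum_le n0 hL l0 la h1 h2 h3; rewrite -/dl.
set S := \sum_(X : _) _; set m := mean_max_matching _ _ _ _ => leS lem.
rewrite /matching_ratio /= -/m ler_pdivlMr // mulrBl lerBlDr -lerBlDl.
rewrite [leRHS]mulrAC ler_pdivlMr //.
have : expR (- (n%:R * dl)) * S <= 1 + 2.
  apply: le_trans (ler_wpM2l (expR_ge0 _) leS) _.
  rewrite mulrDr -expRD addNr expR0 lerD2l ler_piMl // expR_le1 oppr_le0.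
  by rewrite mulr_ge0 // ltW.
move: dn; rewrite ler_pdivrMr //; lra.
Unshelve. all: by end_near.
Qed.

(** * Upper bound from a vertex cover *)

(** A flexible supply node without a regular neighbour has all its edges covered by flexible demand
    nodes and leaves the cover. These nodes are counted by products of indicators to suit
    [expect_avoid]. *)
Lemma max_matching_le_flex (n : nat) (s t : {ffun 'I_n -> 'I_2})
    (E : {set 'I_n * 'I_n}) :
  (forall e, e \in E -> (s e.1 == flexible) || (t e.2 == flexible)) ->
  (max_matching E + \sum_(i < n) (i \in flex_nodes s) *
     [disjoint finset.setX [set i] (~: flex_nodes t) & E] <=
   #|flex_nodes s| + #|flex_nodes t|)%N.
Proof.
move=> hE; pose U := [set i in flex_nodes s |
  [disjoint finset.setX [set i] (~: flex_nodes t) & E]]%SET.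
have -> : (\sum_(i < n) (i \in flex_nodes s) *
     [disjoint finset.setX [set i] (~: flex_nodes t) & E] = #|U|)%N.
  rewrite -sum1_card [RHS]big_mkcond; apply: eq_bigr => i _.
  by rewrite mulnb [i \in U]inE; case: ifP.
have sU : U \subset flex_nodes s.
  by apply/fintype.subsetP => i; rewrite inE => /andP[].
have <- : (#|flex_nodes s :\: U| + #|U| = #|flex_nodes s|)%N.
  by rewrite addnC -[in RHS](cardsID U) (finset.setIidPr sU).
rewrite addnAC leq_add2r; apply: max_matching_cover => -[u w] uwE /=.
have := hE _ uwE; rewrite /= !inE.
have [tw|ntw] := boolP (t w == flexible); first by rewrite !orbT.
rewrite !orbF => su; rewrite su andbT; apply/negP => dis.
suff /(disjointFr dis) : (u, w) \in finset.setX [set u] (~: flex_nodes t).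
  by rewrite uwE.
by rewrite finset.in_setX !inE eqxx.
Qed.

Lemma not_flexible (x : 'I_2) : x != flexible -> x = regular.
Proof. by case: x => -[|[|m]] lt2 // _; apply: val_inj. Qed.

(** The product is rewritten over all demand nodes so that averaging over [t] factors by
    [sum_types_prod]. *)
Lemma prod_avoid_regular (R : realType) (n : nat) (C : 'M[R]_2)
    (s t : {ffun 'I_n -> 'I_2}) (i : 'I_n) : s i = flexible ->
  \prod_(e in finset.setX [set i] (~: flex_nodes t))
     (1 - edge_prob n C (s e.1) (t e.2)) =
  \prod_(j < n)
    (if t j == flexible then 1 else 1 - edge_prob n C flexible regular).
Proof.
move=> si.
transitivity (\prod_(e in finset.setX [set i] (~: flex_nodes t))
    (1 - edge_prob n C flexible regular)).
  apply: eq_bigr => -[u w]; rewrite !inE /= => /andP[/eqP -> tw].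
  by rewrite si (not_flexible tw).
rewrite prodr_const cardsX cards1 mul1n -prodr_const big_mkcond /=.
by apply: eq_bigr => j _; rewrite !inE; case: (t j == flexible).
Qed.

Lemma mean_max_matching_le (R : realType) (n : nat) (bL bR : R) (C : 'M[R]_2) :
  0 <= bL <= 1 -> 0 <= bR <= 1 -> (forall x y, 0 <= C x y) ->
  C regular regular = 0 ->
  mean_max_matching bL bR C n <= n%:R * bL + n%:R * bR -
    n%:R * (bL * (1 - (1 - bR) * edge_prob n C flexible regular) ^+ n).
Proof.
move=> hL hR C0 Crr; set q := edge_prob n C flexible regular.
pose iso (i : 'I_n) (s t : {ffun 'I_n -> 'I_2}) (E : {set 'I_n * 'I_n}) : R :=
  (i \in flex_nodes s)%:R *
  [disjoint finset.setX [set i] (~: flex_nodes t) & E]%:R.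
(* A demand node is harmless if it is flexible or not adjacent to [i]: bR + (1 - bR) (1 - q) = 1 -
   (1 - bR) q. *)
have isoE i : expect bL bR C (iso i) = bL * (1 - (1 - bR) * q) ^+ n.
  rewrite (expect_avoid bL bR C (fun s _ => (i \in flex_nodes s)%:R)
    (fun _ t => finset.setX [set i] (~: flex_nodes t))).
  pose g (_ : 'I_n) (x : 'I_2) : R := if x == flexible then 1 else 1 - q.
  transitivity (\sum_(s : {ffun 'I_n -> 'I_2}) types_prob bL s *
      ((i \in flex_nodes s)%:R *
       \sum_(t : {ffun 'I_n -> 'I_2}) types_prob bR t * \prod_j g j (t j))).
    apply: eq_bigr => s _; congr (_ * _); rewrite mulr_sumr.
    apply: eq_bigr => t _.
    case: (boolP (i \in flex_nodes s)) => [si|_]; last by rewrite !mul0r mulr0.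
    rewrite !mul1r; congr (_ * _); apply: prod_avoid_regular.
    by apply/eqP; rewrite inE in si.
  rewrite sum_types_prod.
  have -> : \prod_(j < n) (bR * g j flexible + (1 - bR) * g j regular) =
            (1 - (1 - bR) * q) ^+ n.
    rewrite -[in RHS](card_ord n) -prodr_const; apply: eq_bigr => j _.
    by rewrite /g /=; ring.
  have := sum_types_flex bL [set i]; rewrite cards1 expr1 => EbL.
  rewrite -[in RHS]EbL mulr_suml.
  by apply: eq_bigr => s _; rewrite finset.sub1set mulrA.
rewrite -{1}(sum_types_card_flex n bL) -(sum_types_card_flex n bR).
rewrite -(expect_supply bL bR C (fun s => #|flex_nodes s|%:R)).
rewrite -(expect_demand bL bR C (fun t => #|flex_nodes t|%:R)) -expectD.
have -> : n%:R * (bL * (1 - (1 - bR) * q) ^+ n) =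
    expect bL bR C (fun s t E => \sum_(i < n) iso i s t E).
  rewrite expect_sum; transitivity (\sum_(i < n) bL * (1 - (1 - bR) * q) ^+ n).
    by rewrite sumr_const card_ord mulr_natl.
  by apply: eq_bigr => i _; rewrite isoE.
rewrite lerBrDr -expectD; apply: expect_le => // s t E nz.
have -> : \sum_(i < n) iso i s t E = (\sum_(i < n) (i \in flex_nodes s) *
     [disjoint finset.setX [set i] (~: flex_nodes t) & E])%:R.
  by rewrite natr_sum; apply: eq_bigr => i _; rewrite /iso natrM.
rewrite -!natrD ler_nat; apply: max_matching_le_flex => e eE.
(* By [Crr] an edge between two regular nodes has probability 0, against [nz]. *)
apply/negPn/negP; rewrite negb_or => /andP[se te]; case/negP: nz.
rewrite /graph_prob (bigD1 e) //= eE (not_flexible se) (not_flexible te).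
by rewrite /edge_prob Crr mul0r min_r ?ler01 // mul0r mulr0.
Qed.

(** Take n-th roots: (1 - y/n) (1 + (y+1)/n) - 1 = (n - y (y+1)) / n^2 >= 0. Giving up a factor e
    makes the bound explicit in n. *)
Lemma expR_le_one_sub_expn (R : realType) (n : nat) (y : R) :
  (0 < n)%N -> 0 <= y -> y * (y + 1) <= n%:R ->
  expR (- (y + 1)) <= (1 - y / n%:R) ^+ n.
Proof.
move=> n0 y0 yn; have nR0 : 0 < n%:R :> R by rewrite ltr0n.
have -> : - (y + 1) = - ((y + 1) / n%:R) * n%:R by field; lra.
rewrite expRM_natr lerXn2r ?nnegrE ?expR_ge0 //.
  by rewrite subr_ge0 ler_pdivrMr //; nra.
have h1 : 0 <= 1 - y / n%:R by rewrite subr_ge0 ler_pdivrMr //; nra.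
rewrite expRN -[leLHS]mul1r ler_pdivrMr ?expR_gt0 //.
apply: le_trans (ler_wpM2l h1 (expR_ge1Dx ((y + 1) / n%:R))).
rewrite -subr_ge0.
have -> : (1 - y / n%:R) * (1 + (y + 1) / n%:R) - 1 =
  (n%:R - y * (y + 1)) / (n%:R * n%:R) by field; lra.
by rewrite divr_ge0 ?mulr_ge0 ?subr_ge0 // ltW.
Qed.

Lemma eta_le (R : realType) (bL bR : R) (C : 'M[R]_2) :
  eta_exists R ->
  0 <= bL <= 1 -> 0 <= bR <= 1 -> (forall x y, 0 <= C x y) ->
  C regular regular = 0 ->
  eta bL bR C <=
  bL + bR - bL * expR (- ((1 - bR) * C flexible regular + 1)).
Proof.
move=> ex hL hR C0 Crr; set y := (1 - bR) * _.
have [/andP[bL0 bL1] /andP[bR0 bR1]] := (hL, hR).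
have y0 : 0 <= y by rewrite mulr_ge0 ?subr_ge0.
apply: limr_le; first exact: ex.
near=> n.
have n0 : (0 < n)%N by near: n; exact: nbhs_infty_gt.
have yn : y * (y + 1) <= n%:R by near: n; exact: nbhs_infty_ger.
have nR0 : 0 < n%:R :> R by rewrite ltr0n.
rewrite /matching_ratio ler_pdivrMr //.
apply: le_trans (mean_max_matching_le n hL hR C0 Crr) _.
rewrite [leRHS]mulrC mulrBr mulrDr lerD2l lerN2 ler_pM2l // ler_wpM2l //.
apply: le_trans (expR_le_one_sub_expn n0 y0 yn) _.
have le_yn : y / n%:R <= 1 by rewrite ler_pdivrMr //; nra.
have le_y : (1 - bR) * edge_prob n C flexible regular <= y / n%:R.
  by rewrite /y -mulrA ler_wpM2l ?subr_ge0 // /edge_prob ge_min lexx orbT.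
rewrite lerXn2r ?nnegrE; lra.
Unshelve. all: by end_near.
Qed.

(** * Choice of the threshold and comparison of the losses *)

Lemma expR_opp_mul_le1 (R : realType) (x : R) : 0 <= x ->
  expR (- x) * (1 + x) <= 1.
Proof.
move=> x0; have := ler_wpM2l (expR_ge0 (- x)) (expR_ge1Dx x).
by rewrite -expRD addNr expR0.
Qed.

Theorem theorem3 (R : realType) (limit_exists : eta_exists R)
  (B : R) (hB : 0 < B < 1) :
  exists alphaf_bar : R, 0 < alphaf_bar /\
    forall alphaf : R, alphaf_bar < alphaf ->
      eta_OS B 0 alphaf > eta_TS B 0 alphaf.
Proof.
have /andP[B0 B1] := hB.
have BB : 0 < B * B by rewrite mulr_gt0.
have BC : 0 < B * (1 - B) by rewrite mulr_gt0 ?subr_gt0.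
(* With l = a B / 8, the bound a B^2 > 1024 yields l > 128 and l^2 >= 16 a, while a B (1 - B) > 24
   yields l (1 - B) > 3. *)
have [u uE] : exists u : R, u = 1024 by exists 1024.
have [v vE] : exists v : R, v = 24 by exists 24.
have u0 : 0 < u / (B * B) by rewrite divr_gt0 // uE; lra.
have v0 : 0 < v / (B * (1 - B)) by rewrite divr_gt0 // vE; lra.
exists (u / (B * B) + v / (B * (1 - B))); split; first by rewrite addr_gt0.
move=> a ha.
have a1 : u < a * (B * B) by rewrite -ltr_pdivrMr //; lra.
have a2 : v < a * (B * (1 - B)) by rewrite -ltr_pdivrMr //; lra.
have a0 : 0 < a by lra.
rewrite {}uE {}vE in a1 a2 *.
pose l := a * B / 8.
have l128 : 128 < l.
  have : a * (B * B) <= a * B by rewrite mulrA ler_piMr ?mulr_ge0 ?ltW.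
  rewrite /l; lra.
have l8 : l *+ 8 <= a by have : a * B <= a by [rewrite ler_piMr ?ltW]; rewrite /l; lra.
have l3 : 3 < l * (1 - B) by rewrite /l; lra.
have C0 x y : 0 <= conn_mx 0 a x y.
  by rewrite mxE; case: ifP => _; [|case: ifP => _]; lra.
have aC y : a <= conn_mx 0 a flexible y.
  by rewrite mxE /=; case: ifP => _; lra.
have Crr : conn_mx 0 a regular regular = 0 by rewrite mxE /= mulr0.
have Cfr : conn_mx 0 a flexible regular = a by rewrite mxE /= add0r.
have p0 := expR_gt0 (- l).
have h1 : a * expR (- (l / 2)) <= 1.
  have -> : expR (- (l / 2)) = expR (- (l / 4)) * expR (- (l / 4)).
    by rewrite -expRD; congr expR; lra.
  have := expR_opp_mul_le1 (_ : 0 <= l / 4); have := expR_gt0 (- (l / 4)).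
  set q := expR _ => q0 hq.
  (* Then a q^2 <= (q l)^2 / 16 <= 1, using 16 a <= l^2. *)
  have ql : q * l <= 4 by have := hq ltac:(lra); lra.
  have ql2 : (q * l) * (q * l) <= 4 * 4 by rewrite ler_pM // mulr_ge0 //; lra.
  have al : 16 * a <= l * l by have := ler_wpM2l (ltW a0) (ltW a1); rewrite /l; lra.
  have := ler_wpM2l (mulr_ge0 (ltW q0) (ltW q0)) al; lra.
have h2 : 4 * expR (- (l / 4)) <= 1.
  have := @expR_opp_mul_le1 R (l / 4) ltac:(lra); have := expR_gt0 (- (l / 4)).
  set q := expR _ => q0.
  have : q * 3 <= q * (l / 4) by rewrite ler_wpM2l ?ltW //; lra.
  lra.
(* With p = exp(-l) the product is at most B + 3 p, and 3 p <= p l (1 - B) <= 1 - B. *)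
have h3 : (expR (- l) + B) * (1 + expR (- l)) <= 1.
  have := @expR_opp_mul_le1 R l ltac:(lra); move: p0; set p := expR _ => p0 hp.
  have pl : p * 1 <= p * l by rewrite ler_wpM2l ?ltW //; lra.
  have p1 : p <= 1 by lra.
  have e1 : p * 3 <= p * (l * (1 - B)) by rewrite ler_pM2l // ltW.
  have e2 : p * l * (1 - B) <= 1 * (1 - B) by rewrite ler_wpM2r //; lra.
  have e3 : p * p <= p * 1 by rewrite ler_pM2l.
  have e4 : p * B <= p * 1 by rewrite ler_pM2l // ltW.
  lra.
have hOS := eta_ge limit_exists (_ : 0 < B <= 1) (_ : 0 <= 0 <= 1) C0 aC _ l8 h1 h2 h3.
have hTS := eta_le limit_exists (_ : 0 <= B / 2 <= 1) (_ : 0 <= B / 2 <= 1) C0 Crr.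
rewrite /eta_OS /eta_TS.
apply: le_lt_trans (hTS _ _) _; try lra.
apply: lt_le_trans (hOS _ _ _); try lra.
rewrite Cfr (_ : B / 2 + B / 2 = B); last by lra.
rewrite ltrD2l ltrN2 ltr_pdivrMr; last by lra.
(* As a B / 2 = 4 l, the one-sided exponent is lower by 3 l - 2, so the extra factor z is at most 1.
   It remains that 2 B e z < (B/2) e l, which holds since l > 4. *)
have -> : 1 + l - a = - ((1 - B / 2) * a + 1) + (2 - l *+ 3) by rewrite /l; lra.
rewrite expRD; set e := expR (- (_ + 1)); have e0 : 0 < e := expR_gt0 _.
have : expR (2 - l *+ 3) <= 1 by rewrite expR_le1; lra.
set z := expR _ => z1.
have ez : e * z <= e * 1 by rewrite ler_wpM2l // ltW.
have bez : B * (e * z) <= B * (e * 1) by rewrite ler_pM2l.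
have be0 : 0 < B * e by rewrite mulr_gt0.
have bel : B * e * 4 < B * e * l by rewrite ltr_pM2l //; lra.
lra.
Qed.
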